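(* Let $\mathcal M$ and $\mathcal N=\{N^{(\lambda)}:\lambda\in\mathbb R_{>0}\}$ be two quasianalytic weight matrices and assume $\sup_{k\in\mathbb N_{>0}}(n^{(\lambda)}_k)^{1/k}=+\infty$ for all $\lambda>0$. Then $\Lambda^r_{\{\mathcal N\}}\setminus j^\infty(\mathcal E^{0,r}_{\{\mathcal M\}})$ is dense in $\Lambda^r_{\{\mathcal N\}}$.
   Context: For a sequence $M=(M_p)_{p\in\mathbb N}$ of positive reals write $m_p:=M_p/p!$. $M$ is a weight sequence if $1=M_0\le M_1$, $M_p^2\le M_{p-1}M_{p+1}$ for all $p\ge1$, and $\liminf_{p\to\infty}m_p^{1/p}>0$; it is quasianalytic if $\sum_{p\ge1}M_{p-1}/M_p=+\infty$. A weight matrix is a family $\mathcal M=\{M^{(\lambda)}:\lambda\in\mathbb R_{>0}\}$ of weight sequences with $M^{(\lambda)}_p\le M^{(\kappa)}_p$ for all $p$ whenever $\lambda\le\kappa$; write $n^{(\lambda)}_p:=N^{(\lambda)}_p/p!$. It is quasianalytic if every member is quasianalytic. For $U\subseteq\mathbb R^r$ open, $K\subseteq U$ compact, $h>0$: $\|f\|^M_{K,h}:=\sup_{\alpha\in\mathbb N^r,x\in K}|\partial^\alpha f(x)|/(h^{|\alpha|}M_{|\alpha|})$. $\mathcal E_{\{\mathcal M\}}(U)$: smooth $f$ such that for every compact $K\subseteq U$ there exist $\lambda>0$, $h>0$ with $\|f\|^{M^{(\lambda)}}_{K,h}<\infty$; $\mathcal E^{0,r}_{\{\mathcal M\}}$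 is the space of germs at $0\in\mathbb R^r$ of functions in $\mathcal E_{\{\mathcal M\}}((-1/k,1/k)^r)$ for some $k$. For $\mathbf b=(b_\alpha)_{\alpha\in\mathbb N^r}$, a weight sequence $N$, $h>0$: $|\mathbf b|^N_h:=\sup_\alpha|b_\alpha|/(h^{|\alpha|}n_{|\alpha|})$; $\Lambda^r_{\{\mathcal N\}}:=\{\mathbf b:\exists\lambda>0\,\exists h>0,\ |\mathbf b|^{N^{(\lambda)}}_h<\infty\}$, endowed with the inductive limit topology of the Banach spaces $\{\mathbf b:|\mathbf b|^{N^{(n)}}_n<\infty\}$, $n\in\mathbb N_{>0}$. The Borel map is $j^\infty(f)=(\partial^\alpha f(0)/|\alpha|!)_{\alpha\in\mathbb N^r}$. *)

(* Defs.v *)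
From Stdlib Require Import Reals List Factorial.
From mathcomp Require Import ssreflect ssrbool eqtype ssrnat fintype bigop.
Set Implicit Arguments.
Unset Strict Implicit.

Local Open Scope R_scope.

Definition pt (r : nat) := 'I_r -> R.
Definition mindex (r : nat) := 'I_r -> nat.

Definition mlen (r : nat) (a : mindex r) : nat := (\sum_(i < r) a i)%N.

Definition mincr (r : nat) (a : mindex r) (i : 'I_r) : mindex r :=
  fun j => if j == i then S (a j) else a j.

Definition mzero (r : nat) : mindex r := fun _ => 0%nat.

Definition upd (r : nat) (x : pt r) (i : 'I_r) (t : R) : pt r :=
  fun j => if j == i then t else x j.

Definition mseq (M : nat -> R) (p : nat) : R := M p / INR (Factorial.fact p).

Definition WeightSeq (M : nat -> R) : Prop :=
  (forall p, 0 < M p) /\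
  M 0%nat = 1 /\ M 0%nat <= M 1%nat /\
  (forall p, (1 <= p)%nat -> (M p)^2 <= M (p - 1)%nat * M (p + 1)%nat) /\
  (exists c, 0 < c /\ exists P, forall p, (P <= p)%nat -> (1 <= p)%nat ->
        c <= Rpower (mseq M p) (/ INR p)).

Definition Quasianalytic (M : nat -> R) : Prop :=
  forall B : R, exists n : nat,
    B < sum_f_R0 (fun k => M k / M (S k)) n.

(** A weight matrix {M^(lambda) : lambda > 0}, indexed by lambda : R
    (values for lambda <= 0 are irrelevant). *)
Definition WeightMatrix (Mat : R -> nat -> R) : Prop :=
  (forall l, 0 < l -> WeightSeq (Mat l)) /\
  (forall l k, 0 < l -> l <= k -> forall p, Mat l p <= Mat k p).

Definition QuasianalyticMatrix (Mat : R -> nat -> R) : Prop :=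
  forall l, 0 < l -> Quasianalytic (Mat l).

Definition IsOpen (r : nat) (O : pt r -> Prop) : Prop :=
  forall x, O x -> exists d, 0 < d /\
    forall y : pt r, (forall j, Rabs (y j - x j) < d) -> O y.

Definition IsCompact (r : nat) (K : pt r -> Prop) : Prop :=
  forall (I : Type) (O : I -> pt r -> Prop),
    (forall i, IsOpen (O i)) ->
    (forall x, K x -> exists i, O i x) ->
    exists l : list I, forall x, K x -> exists i, In i l /\ O i x.

Definition cube (r k : nat) : pt r -> Prop :=
  fun x => forall j, Rabs (x j) < / INR k.

(** g is the family of all partial derivatives of f on the open set U:
    g 0 = f on U, each g alpha is continuous on U, and
    d/dx_i (g alpha) = g (alpha + e_i) on U.  (Continuous partial
    derivatives of all orders, i.e. f is C^infinity on U with
    partial^alpha f = g alpha on U.) *)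
Definition SmoothWithDerivs (r : nat) (U : pt r -> Prop) (f : pt r -> R)
    (g : mindex r -> pt r -> R) : Prop :=
  (forall x, U x -> g (@mzero r) x = f x) /\
  (forall a x, U x -> forall eps, 0 < eps -> exists d, 0 < d /\
      forall y, U y -> (forall j, Rabs (y j - x j) < d) ->
        Rabs (g a y - g a x) < eps) /\
  (forall a i x, U x ->
      derivable_pt_lim (fun t => g a (upd x i t)) (x i) (g (mincr a i) x)).

Definition RoumieuWithDerivs (Mat : R -> nat -> R) (r : nat)
    (U : pt r -> Prop) (f : pt r -> R) (g : mindex r -> pt r -> R) : Prop :=
  SmoothWithDerivs U f g /\
  forall K : pt r -> Prop, IsCompact K -> (forall x, K x -> U x) ->
    exists l h C, 0 < l /\ 0 < h /\
      forall (a : mindex r) (x : pt r), K x ->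
        Rabs (g a x) <= C * (h ^ mlen a * Mat l (mlen a)).

Definition InJetImage (Mat : R -> nat -> R) (r : nat)
    (b : mindex r -> R) : Prop :=
  exists (k : nat) (f : pt r -> R) (g : mindex r -> pt r -> R),
    (1 <= k)%nat /\ RoumieuWithDerivs Mat (@cube r k) f g /\
    forall a, b a = g a (fun _ => 0) / INR (Factorial.fact (mlen a)).

Definition seqnorm_le (N : nat -> R) (h : R) (r : nat)
    (b : mindex r -> R) (C : R) : Prop :=
  forall a, Rabs (b a) <= C * (h ^ mlen a * mseq N (mlen a)).

Definition InLambda (Nat : R -> nat -> R) (r : nat) (b : mindex r -> R) : Prop :=
  exists l h C, 0 < l /\ 0 < h /\ seqnorm_le (Nat l) h b C.

(** W is a 0-neighbourhood basis element of the (locally convex) inductive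
    limit topology of the Banach spaces
    Lambda_n = {b : |b|^{N^(n)}_n < oo}, n >= 1: an absolutely convex
    subset of Lambda whose trace on each Lambda_n contains a ball. *)
Definition LBZeroNbhd (Nat : R -> nat -> R) (r : nat)
    (W : (mindex r -> R) -> Prop) : Prop :=
  (forall b, W b -> InLambda Nat b) /\
  (forall b c s t, W b -> W c -> Rabs s + Rabs t <= 1 ->
       W (fun a => s * b a + t * c a)) /\
  (forall n : nat, (1 <= n)%nat -> exists eps, 0 < eps /\
       forall c, seqnorm_le (Nat (INR n)) (INR n) c eps -> W c).

Definition DenseInLambda (Nat : R -> nat -> R) (r : nat)
    (D : (mindex r -> R) -> Prop) : Prop :=
  (forall b, D b -> InLambda Nat b) /\
  forall b, InLambda Nat b -> forall W, LBZeroNbhd Nat W ->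
    exists c, W c /\ D (fun a => b a + c a).

(* Main.v *)
Require Import Defs.
From Stdlib Require Import Reals List Factorial.
From Stdlib Require Import Lra Lia Classical FunctionalExtensionality.
From mathcomp Require Import ssreflect ssrfun ssrbool eqtype ssrnat fintype bigop.

(** The jet image is a linear space, so it suffices to exhibit one element of
    Lambda outside it: [b a = n_|a|] for the member [N^(1)] of the matrix [Nat].
    Restrict a function with this jet to a coordinate axis.  Its derivatives at
    0 are nonnegative, and a one-sided version of Bang's proof of the
    Denjoy-Carleman theorem, applied to the negative parts of the derivatives,
    shows that all derivatives stay nonnegative on some [0, d].  As in
    Bernstein's theorem, Taylor coefficients at 0 then grow at most like
    [d^-k], contradicting [sup n_k^(1/k) = +oo]. *)

Local Open Scope R_scope.

(** * Elementary calculus: comparison through derivatives *)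

Lemma derivable_pt_lim_le_compare (u v u' v' : R -> R) (a b : R) :
  a <= b ->
  (forall t, a <= t <= b -> derivable_pt_lim u t (u' t)) ->
  (forall t, a <= t <= b -> derivable_pt_lim v t (v' t)) ->
  (forall t, a <= t <= b -> u' t <= v' t) ->
  u a <= v a -> u b <= v b.
Proof.
move=> leab du dv le' lea.
case: (Rle_lt_or_eq_dec _ _ leab) => [ltab|<- //].
have [c [E c_in]] : exists c, (v - u)%F b - (v - u)%F a = (v' c - u' c) * (b - a)
    /\ a < c < b.
  apply: (MVT_cor2 (v - u)%F (fun c => v' c - u' c)) => // c c_in.
  by apply: derivable_pt_lim_minus; [exact: dv|exact: du].
have := le' c ltac:(lra); rewrite /minus_fct in E; nra.
Qed.

Lemma derivable_pt_lim_affine (a w x0 x : R) :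
  derivable_pt_lim (fun t => a + w * (t - x0)) x w.
Proof.
have E : 0 + w * (1 - 0) = w by ring.
rewrite -{2}E; apply: (derivable_pt_lim_plus (fct_cte a)).
  exact: derivable_pt_lim_const.
apply: derivable_pt_lim_scal; apply: (derivable_pt_lim_minus id (fct_cte x0)).
  exact: derivable_pt_lim_id.
exact: derivable_pt_lim_const.
Qed.

(** * Bang's argument on an interval *)

Section DerivativeSequence.

Variables (F : nat -> R -> R) (d : R).
Hypothesis dF : forall n t, 0 <= t <= d -> derivable_pt_lim (F n) t (F (S n) t).

Section Bang.

Variable A : nat -> R.
Hypothesis A_gt0 : forall n, 0 < A n.
Hypothesis A_logconvex : forall n m, le n m -> A (S n) * A m <= A n * A (S m).
Hypothesis F_ge : forall n t, 0 <= t <= d -> - A n <= F n t.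

(** The right-hand sides form a barrier for the system [F n' = F (S n)]: the rate
    [exp 1 * (A (S N) / A N)] is chosen so that for [n <= N] the derivative of the n-th barrier
    dominates the (n+1)-st one. *)
Lemma negative_part_growth (N : nat) (x0 x : R) :
  0 <= x0 -> x0 <= x -> x <= d ->
  (forall n, - F n x0 <= A n * exp (INR n - INR (S N))) ->
  forall n, - F n x <=
    A n * exp (INR n - INR (S N) + exp 1 * (A (S N) / A N) * (x - x0)).
Proof.
move=> x0_ge0 lex0x lexd H0.
set w := exp 1 * (A (S N) / A N).
have w_gt0 : 0 < w.
  apply: Rmult_lt_0_compat; first exact: exp_pos.
  exact: Rdiv_lt_0_compat.
(* From level [S N] on the exponent is nonnegative, so the a priori bound [F_ge] suffices. *)
have high n t : le (S N) n -> x0 <= t <= x ->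
    - F n t <= A n * exp (INR n - INR (S N) + w * (t - x0)).
  move=> leNn t_in.
  have leNn' := le_INR _ _ leNn.
  have pos : 0 <= w * (t - x0) by nra.
  have := F_ge n t ltac:(lra); have := A_gt0 n.
  have := exp_ineq1_le (INR n - INR (S N) + w * (t - x0)); nra.
(* Below that level, descending induction on [n], with [j] the distance to [S N]; each step
   integrates the bound for [F (S n)] from [x0]. *)
have low j : forall n, (n + j)%coq_nat = S N -> forall t, x0 <= t <= x ->
    - F n t <= A n * exp (INR n - INR (S N) + w * (t - x0)).
  elim: j => [|j IH] n Ej t t_in; first by apply: high => //; lia.
  apply: (@derivable_pt_lim_le_compare (- F n)%F
    (fun t => A n * exp (INR n - INR (S N) + w * (t - x0)))
    (fun t => - F (S n) t)
    (fun t => A n * (exp (INR n - INR (S N) + w * (t - x0)) * w)) x0 t).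
  - lra.
  - move=> s s_in; apply: derivable_pt_lim_opp; apply: dF; lra.
  - move=> s s_in; apply: derivable_pt_lim_scal.
    apply: (derivable_pt_lim_comp (fun t => INR n - INR (S N) + w * (t - x0)) exp);
      last exact: derivable_pt_lim_exp.
    exact: derivable_pt_lim_affine.
  - move=> s s_in; apply: Rle_trans (IH (S n) _ s _) _; [lia|lra|].
    set y := w * (s - x0).
    rewrite S_INR.
    have -> : INR n + 1 - INR (S N) + y = 1 + (INR n - INR (S N) + y) by ring.
    rewrite exp_plus.
    have := exp_pos (INR n - INR (S N) + y); set E := exp _ => E_gt0.
    (* By log-convexity the ratio [A (S n) / A n] is at most [A (S N) / A N]. *)
    have step : A (S n) <= A n * (A (S N) / A N).
      apply: (Rmult_le_reg_r (A N)) => //.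
      have -> : A n * (A (S N) / A N) * A N = A n * A (S N).
        by field; apply: Rgt_not_eq; exact: A_gt0.
      by apply: A_logconvex; lia.
    have -> : A n * (E * w) = A n * (A (S N) / A N) * (exp 1 * E) by rewrite /w; ring.
    apply: Rmult_le_compat_r => //.
    have := exp_pos 1; nra.
  - by rewrite /opp_fct Rminus_diag Rmult_0_r Rplus_0_r; exact: H0.
move=> n; case: (Nat.le_gt_cases (S N) n) => [leNn|ltnN].
  by apply: high => //; lra.
by apply: (low (S N - n)%coq_nat); [lia|lra].
Qed.

(** Over this length the barrier's exponent gains at most 1, so moving right costs one level: [S N]
    becomes [N]. *)
Lemma negative_part_step (N : nat) (x0 x : R) :
  0 <= x0 -> x0 <= x -> x <= d -> x <= x0 + exp (-1) * (A N / A (S N)) ->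
  (forall n, - F n x0 <= A n * exp (INR n - INR (S N))) ->
  forall n, - F n x <= A n * exp (INR n - INR N).
Proof.
move=> x0_ge0 lex0x lexd short H0 n.
apply: Rle_trans (negative_part_growth N x0 x x0_ge0 lex0x lexd H0 n) _.
apply: Rmult_le_compat_l; first exact: Rlt_le.
have le1 : exp 1 * (A (S N) / A N) * (x - x0) <= 1.
  have E : exp 1 * (A (S N) / A N) * (exp (-1) * (A N / A (S N))) = 1.
    have -> : exp (-1) = / exp 1 by rewrite -exp_Ropp.
    field; repeat split; apply: Rgt_not_eq; try exact: A_gt0; exact: exp_pos.
  rewrite -[X in _ <= X]E.
  apply: Rmult_le_compat_l; last lra.
  apply: Rlt_le; apply: Rmult_lt_0_compat; first exact: exp_pos.
  exact: Rdiv_lt_0_compat.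
have : INR n - INR (S N) + exp 1 * (A (S N) / A N) * (x - x0) <= INR n - INR N.
  by rewrite S_INR; lra.
by case/Rle_lt_or_eq_dec=> [/exp_increasing/Rlt_le|->] //; exact: Rle_refl.
Qed.

Hypothesis A_quasi : Quasianalytic A.
Hypothesis F0_ge0 : forall n, 0 <= F n 0.

(** At 0 the estimate holds at every level. Starting from level [K + j + 1], [j] steps descend to
    level [K + 1]; their lengths [exp (-1) * (A k / A (S k))], for [k] from [K + 1] to [K + j], add
    up to the allowed distance. *)
Lemma negative_part_chain (j K : nat) (x : R) :
  let S n := sum_f_R0 (fun k => A k / A (S k)) n in
  0 <= x <= d -> x <= exp (-1) * (S (K + j)%coq_nat - S K) ->
  forall n, - F n x <= A n * exp (INR n - INR K.+1).
Proof.
move=> Sum; elim: j K x => [|j IH] K x x_in short n.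
  have -> : x = 0 by rewrite Nat.add_0_r in short; nra.
  have := F0_ge0 n; have := A_gt0 n; have := exp_pos (INR n - INR K.+1); nra.
set s := exp (-1) * (A K.+1 / A K.+2).
have s_gt0 : 0 < s.
  apply: Rmult_lt_0_compat; first exact: exp_pos.
  exact: Rdiv_lt_0_compat.
have SumS : Sum K.+1 = Sum K + A K.+1 / A K.+2 by [].
have H0 x0 : 0 <= x0 <= d -> x0 <= exp (-1) * (Sum (K.+1 + j)%coq_nat - Sum K.+1) ->
    x0 <= x -> x <= x0 + s -> - F n x <= A n * exp (INR n - INR K.+1).
  move=> x0_in short0 le0 le1.
  apply: (negative_part_step K.+1 x0); rewrite -?/s; try lra.
  exact: IH.
have short' : x - s <= exp (-1) * (Sum (K.+1 + j)%coq_nat - Sum K.+1).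
  rewrite SumS; have -> : (K.+1 + j = K + j.+1)%coq_nat by lia.
  rewrite /s; lra.
(* The last step starts at [x - s], or at 0 if that point is negative; in the latter case it remains
   to see that the partial sums increase. *)
case: (Rle_lt_dec 0 (x - s)) => s_x.
  by apply: (H0 (x - s)); lra.
apply: (H0 0); try lra.
apply: Rmult_le_pos; first exact: Rlt_le (exp_pos _).
elim: (j) => [|i IHi]; first by rewrite Nat.add_0_r; lra.
rewrite Nat.add_succ_r /Sum /= -/(Sum _) -/(Sum _).
have := Rdiv_lt_0_compat _ _ (A_gt0 (K.+1 + i)%coq_nat.+1) (A_gt0 (K.+1 + i)%coq_nat.+2).
move: IHi; rewrite /Sum /=; lra.
Qed.

(** Divergence of the sum of [A k / A (S k)] lets the chain reach [x] while ending at any prescribed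
    level [K + 1]. Hence [- F n x <= A n * exp (n - K - 1)] for every [K], which forces the sign as
    [K] grows. *)
Lemma derivatives_ge0 (n : nat) (x : R) : 0 <= x <= d -> 0 <= F n x.
Proof.
move=> x_in; apply: Rnot_lt_le => neg.
(* Since [exp (K + 1) > K], this [K] makes the chain's bound smaller than [- F n x]. *)
have [K HK] := INR_unbounded (A n * exp (INR n) / (- F n x)).
set Sum := sum_f_R0 (fun k => A k / A (S k)).
have [m Hm] := A_quasi (x * exp 1 + Sum K).
have le2 : Sum m <= Sum (K + m)%coq_nat.
  rewrite Nat.add_comm; elim: K {HK Hm} => [|q IH]; first by rewrite Nat.add_0_r; lra.
  rewrite Nat.add_succ_r; apply: Rle_trans IH _; rewrite /Sum /=.
  have := Rdiv_lt_0_compat _ _ (A_gt0 (m + q)%coq_nat.+1) (A_gt0 (m + q)%coq_nat.+2).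
  lra.
have := @negative_part_chain m K x x_in _ n.
have far : x <= exp (-1) * (Sum (K + m)%coq_nat - Sum K).
  have E1 : exp (-1) * exp 1 = 1 by rewrite -exp_plus -{2}exp_0; congr exp; ring.
  have -> : x = exp (-1) * (x * exp 1) by rewrite (Rmult_comm x) -Rmult_assoc E1 Rmult_1_l.
  apply: Rmult_le_compat_l; first exact: Rlt_le (exp_pos _).
  rewrite -/Sum in Hm; lra.
move/(_ far).
have big : INR K < exp (INR K.+1).
  by have := exp_ineq1_le (INR K.+1); rewrite S_INR; lra.
rewrite /Rminus exp_plus exp_Ropp => H.
have E_gt0 := exp_pos (INR K.+1).
have H1 : - F n x * exp (INR K.+1) <= A n * exp (INR n).
  have -> : A n * exp (INR n) =
      A n * (exp (INR n) * / exp (INR K.+1)) * exp (INR K.+1).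
    by field; apply: Rgt_not_eq.
  by apply: Rmult_le_compat_r; lra.
have H2 : A n * exp (INR n) < - F n x * INR K.
  have -> : A n * exp (INR n) = - F n x * (A n * exp (INR n) / - F n x).
    by field; lra.
  by apply: Rmult_lt_compat_l; lra.
nra.
Qed.

End Bang.

(** [F k] is nondecreasing, so [F k >= F k 0]; integrating this [k] times from 0, with nonnegative
    initial values, leaves the k-th Taylor term below [F 0]. *)
Lemma nonnegative_derivatives_taylor (k : nat) :
  0 <= d -> (forall n t, 0 <= t <= d -> 0 <= F n t) ->
  F k 0 / INR (Factorial.fact k) * d ^ k <= F 0%N d.
Proof.
move=> d_ge0 F_ge0.
have H j : forall n, (n + j)%coq_nat = k -> forall t, 0 <= t <= d ->
    F k 0 / INR (Factorial.fact j) * t ^ j <= F n t.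
  elim: j => [|j IH] n Ej t t_in.
    have {Ej} <- : n = k by lia.
    rewrite /= Rdiv_1_r Rmult_1_r.
    apply: (@derivable_pt_lim_le_compare (fct_cte (F n 0)) (F n)
              (fun _ => 0) (F (S n)) 0 t); try lra.
    - by move=> s _; exact: derivable_pt_lim_const.
    - by move=> s s_in; apply: dF; lra.
    - by move=> s s_in; apply: F_ge0; lra.
    - by rewrite /fct_cte; lra.
  apply: (@derivable_pt_lim_le_compare
    (fun s => F k 0 / INR (Factorial.fact (S j)) * s ^ (S j)) (F n)
    (fun s => F k 0 / INR (Factorial.fact (S j)) * (INR (S j) * s ^ j)) (F (S n)) 0 t).
  - lra.
  - by move=> s _; apply: derivable_pt_lim_scal; exact: (derivable_pt_lim_pow s (S j)).
  - by move=> s s_in; apply: dF; lra.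
  - move=> s s_in; apply: Rle_trans (IH (S n) _ s _); [|lia|lra].
    rewrite fact_simpl mult_INR; apply: Req_le; field.
    by split; [exact: INR_fact_neq_0|exact: not_0_INR].
  - by rewrite /= Rmult_0_l Rmult_0_r; apply: F_ge0; lra.
apply: H => //; lra.
Qed.

End DerivativeSequence.

(** * Restriction to a coordinate axis *)

(** The ratios [M (S p) / M p] are nondecreasing; the induction on [m] multiplies by [M p] and
    passes through [M n * M (S p) * M (S p)]. *)
Lemma weight_seq_logconvex (M : nat -> R) (n m : nat) :
  WeightSeq M -> le n m -> M (S n) * M m <= M n * M (S m).
Proof.
move=> [M_gt0 [_ [_ [lc _]]]]; elim=> [|p _ IH]; first lra.
have := lc (S p) isT; rewrite subn1 addn1 /= => lcp.
have := M_gt0 p; have := M_gt0 (S p); have := M_gt0 n => gn gp1 gp.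
apply: (Rmult_le_reg_r (M p)) => //.
apply: (Rle_trans _ (M n * M (S p) * M (S p))); first by nra.
nra.
Qed.

(** Rescaling divides every ratio [M k / M (S k)] by [h]. *)
Lemma quasianalytic_rescale (M : nat -> R) (C h : R) :
  (forall n, 0 < M n) -> 0 < C -> 0 < h -> Quasianalytic M ->
  Quasianalytic (fun n => C * (h ^ n * M n)).
Proof.
move=> M_gt0 C_gt0 h_gt0 qa B.
have [n Hn] := qa (h * B); exists n.
rewrite (PartSum.sum_eq _ (fun k => M k / M (S k) * / h)); last first.
  move=> i _ /=; field.
  have := pow_lt h i h_gt0; have := M_gt0 (S i); lra.
rewrite -scal_sum.
apply: (Rmult_lt_reg_l h) => //.
rewrite -Rmult_assoc Rinv_r; lra.
Qed.

Definition axis {r : nat} (i : 'I_r) (t : R) : pt r := upd (fun _ => 0) i t.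

(** The multi-index [n * e_i]; with [iter], the next one is [mincr] of the current one by
    conversion, as the derivative relation requires. *)
Definition axis_index {r : nat} (i : 'I_r) (n : nat) : mindex r :=
  iter n (fun a => mincr a i) (@mzero r).

Lemma upd_axis (r : nat) (i : 'I_r) (s t : R) : upd (axis i s) i t = axis i t.
Proof. by apply: functional_extensionality => j; rewrite /axis /upd; case: eqP. Qed.

Lemma axis0 (r : nat) (i : 'I_r) : axis i 0 = (fun _ => 0).
Proof. by apply: functional_extensionality => j; rewrite /axis /upd; case: eqP. Qed.

Lemma mlen_mincr (r : nat) (a : mindex r) (i : 'I_r) : mlen (mincr a i) = S (mlen a).
Proof.
rewrite /mlen (bigD1 i) //= [in RHS](bigD1 i) //= /mincr eqxx addSn.
congr (_.+1); congr addn; apply: eq_bigr => j /negbTE -> //.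
Qed.

Lemma mlen_axis_index (r : nat) (i : 'I_r) (n : nat) : mlen (axis_index i n) = n.
Proof.
elim: n => [|n IH]; first by rewrite /mlen big1.
by rewrite /= mlen_mincr -/(axis_index i n) IH.
Qed.

(** Heine-Borel by the supremum argument: [P s] says that the segment up to [s] has a finite
    subcover, and the supremum of such [s] must be [d]. *)
Lemma axis_segment_compact (r : nat) (i : 'I_r) (d : R) : 0 <= d ->
  IsCompact (fun x => exists t, 0 <= t <= d /\ x = axis i t).
Proof.
move=> d_ge0 I O O_open cover.
pose P s := 0 <= s <= d /\ exists l : list I, forall t, 0 <= t <= s ->
  exists k, In k l /\ O k (axis i t).
have local t : 0 <= t <= d -> exists k e, 0 < e /\
    forall s, Rabs (s - t) < e -> O k (axis i s).
  move=> t_in; have [k Ok] := cover (axis i t) (ex_intro _ t (conj t_in erefl)).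
  have [e [e_gt0 He]] := O_open k _ Ok; exists k, e; split=> // s s_t.
  apply: He => j; rewrite /axis /upd; case: eqP => // _.
  by rewrite Rminus_0_r Rabs_R0.
have P0 : P 0.
  split; first lra.
  have [k [e [e_gt0 He]]] := local 0 ltac:(lra).
  exists (k :: nil) => t t_in; exists k; split; first by left.
  by apply: He; apply: Rabs_def1; lra.
have [m [m_ub m_lub]] : {m | is_lub P m}.
  apply: completeness; last by exists 0.
  by exists d => s [] [].
have m_in : 0 <= m <= d.
  by split; [exact: m_ub|apply: m_lub => s [] []].
have [k [e [e_gt0 He]]] := local m m_in.
have [s [Ps ltms]] : exists s, P s /\ m - e < s.
  apply: NNPP => none; have : m <= m - e; last lra.
  apply: m_lub => s Ps; apply: Rnot_lt_le => lts; apply: none.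
  by exists s.
have [s_in [l Hl]] := Ps.
(* One more set, a neighbourhood of the supremum [m], prolongs a cover reaching beyond [m - e] to
   one reaching up to [m + e]. *)
have ext : forall t, 0 <= t < m + e -> exists k', In k' (k :: l) /\ O k' (axis i t).
  move=> t t_in; case: (Rle_lt_dec t s) => ts.
    have [k' [? ?]] := Hl t ltac:(lra).
    by exists k'; split=> //; right.
  by exists k; split; [left|apply: He; apply: Rabs_def1; lra].
have md : m = d.
  apply: NNPP => neq.
  have Pz : P (Rmin d (m + e / 2)).
    split; first by split; [apply: Rmin_glb; lra|exact: Rmin_l].
    exists (k :: l) => t t_in; apply: ext.
    have := Rmin_r d (m + e / 2); lra.
  have := m_ub _ Pz; rewrite /Rmin; case: Rle_dec; lra.
exists (k :: l) => x [t [t_in ->]].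
by apply: ext; lra.
Qed.

(* One-dimensional shadow of membership in the jet image, on the one-sided
   segment [0, d] and with a single weight sequence. *)
Definition AxisJet (Mat : R -> nat -> R) (c : nat -> R) : Prop :=
  exists d l h C (F : nat -> R -> R), 0 < d /\ 0 < l /\ 0 < h /\ 0 < C /\
    (forall n t, 0 <= t <= d -> derivable_pt_lim (F n) t (F (S n) t)) /\
    (forall n t, 0 <= t <= d -> Rabs (F n t) <= C * (h ^ n * Mat l n)) /\
    (forall n, F n 0 = c n * INR (Factorial.fact n)).

Lemma jet_image_axis (Mat : R -> nat -> R) (r : nat) (i : 'I_r) (b : mindex r -> R) :
  WeightMatrix Mat -> InJetImage Mat b -> AxisJet Mat (fun n => b (axis_index i n)).
Proof.
move=> [wM _] [k [f [g [k_gt0 [[[_ [_ dg]] bound] bE]]]]].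
have k_pos : 0 < INR k by apply: lt_0_INR; apply/ltP.
have ik_pos := Rinv_0_lt_compat _ k_pos.
(* Half the side keeps the closed segment inside the open cube. *)
pose d := / INR k / 2.
have in_cube t : 0 <= t <= d -> cube k (axis i t).
  move=> t_in j; rewrite /axis /upd; case: eqP => _.
    by rewrite Rabs_pos_eq; rewrite /d in t_in; lra.
  by rewrite Rabs_R0.
have [l [h [C [l_gt0 [h_gt0 HC]]]]] :=
  bound _ (@axis_segment_compact r i d ltac:(rewrite /d; lra))
    (fun x '(ex_intro t (conj t_in xE)) => eq_ind_r _ (in_cube t t_in) xE).
exists d, l, h, (Rabs C + 1), (fun n t => g (axis_index i n) (axis i t)).
split; first by rewrite /d; lra.
do 2!split=> //.
split; first by have := Rabs_pos C; lra.
split; [|split].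
- move=> n t t_in.
  have := dg (axis_index i n) i _ (in_cube t t_in).
  have -> : (fun s => g (axis_index i n) (upd (axis i t) i s)) =
            (fun s => g (axis_index i n) (axis i s)).
    by apply: functional_extensionality => s; rewrite upd_axis.
  by have -> : axis i t i = t by rewrite /axis /upd eqxx.
- move=> n t t_in.
  have := HC (axis_index i n) (axis i t) (ex_intro _ t (conj t_in erefl)).
  rewrite mlen_axis_index => H; apply: Rle_trans H _.
  apply: Rmult_le_compat_r; last by have := Rle_abs C; lra.
  apply: Rmult_le_pos; first exact: pow_le (Rlt_le _ _ h_gt0).
  by apply: Rlt_le; case: (wM l l_gt0).
- move=> n; rewrite bE mlen_axis_index axis0; field; exact: INR_fact_neq_0.
Qed.

(** * Differences of axis jets and the geometric bound *)

Lemma weighted_bound_mono (Mat : R -> nat -> R) (C h h' l l' : R) (n : nat) :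
  WeightMatrix Mat -> 0 <= C -> 0 < h <= h' -> 0 < l <= l' ->
  C * (h ^ n * Mat l n) <= C * (h' ^ n * Mat l' n).
Proof.
move=> [wM mM] C_ge0 h_le l_le.
apply: Rmult_le_compat_l => //.
apply: Rmult_le_compat.
- by apply: pow_le; lra.
- by apply: Rlt_le; case: (wM l ltac:(lra)).
- by apply: pow_incr; lra.
- by apply: mM; lra.
Qed.

Lemma axis_jet_sub (Mat : R -> nat -> R) (b c : nat -> R) :
  WeightMatrix Mat -> AxisJet Mat b -> AxisJet Mat c ->
  AxisJet Mat (fun n => c n - b n).
Proof.
move=> wM [d1 [l1 [h1 [C1 [F [? [? [? [? [dF [bF F0]]]]]]]]]]].
move=> [d2 [l2 [h2 [C2 [G [? [? [? [? [dG [bG G0]]]]]]]]]]].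
exists (Rmin d1 d2), (Rmax l1 l2), (Rmax h1 h2), (C1 + C2), (fun n => (G n - F n)%F).
have := Rmin_l d1 d2; have := Rmin_r d1 d2.
have := Rmax_l l1 l2; have := Rmax_r l1 l2.
have := Rmax_l h1 h2; have := Rmax_r h1 h2 => ? ? ? ? ? ?.
split; first exact: Rmin_pos.
do 3!(split; first lra).
split; [|split].
- by move=> n t t_in; apply: derivable_pt_lim_minus; [apply: dG|apply: dF]; lra.
- move=> n t t_in; rewrite /minus_fct.
  apply: Rle_trans (Rabs_triang _ _) _; rewrite Rabs_Ropp Rmult_plus_distr_r Rplus_comm.
  apply: Rplus_le_compat.
    apply: Rle_trans (bF n t ltac:(lra)) _; apply: weighted_bound_mono => //; lra.
  apply: Rle_trans (bG n t ltac:(lra)) _; apply: weighted_bound_mono => //; lra.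
- by move=> n; rewrite /minus_fct F0 G0; ring.
Qed.

(** Bang's argument makes all [F n] nonnegative on the segment; the Taylor bound at [d] then gives
    [c n <= F 0 d / d ^ n]. *)
Lemma axis_jet_nonneg_bound (Mat : R -> nat -> R) (c : nat -> R) :
  WeightMatrix Mat -> QuasianalyticMatrix Mat ->
  (forall n, 0 <= c n) -> AxisJet Mat c ->
  exists B q, 0 < B /\ 0 < q /\ forall n, c n <= B * q ^ n.
Proof.
move=> [wM _] qM c_ge0 [d [l [h [C [F [d_gt0 [l_gt0 [h_gt0 [C_gt0 [dF [bF F0]]]]]]]]]]].
have wMl := wM l l_gt0; have Ml_gt0 := proj1 wMl.
have F_ge0 n t : 0 <= t <= d -> 0 <= F n t.
  (* The constants [C] and [h] are absorbed into the weights, which stay log-convex and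
     quasianalytic. *)
  apply: (@derivatives_ge0 F d dF (fun n => C * (h ^ n * Mat l n))).
  - by move=> m; do !apply: Rmult_lt_0_compat => //; exact: pow_lt.
  - move=> p q lepq /=.
    have -> : C * (h * h ^ p * Mat l p.+1) * (C * (h ^ q * Mat l q)) =
              C * C * h * (h ^ p * h ^ q) * (Mat l p.+1 * Mat l q) by ring.
    have -> : C * (h ^ p * Mat l p) * (C * (h * h ^ q * Mat l q.+1)) =
              C * C * h * (h ^ p * h ^ q) * (Mat l p * Mat l q.+1) by ring.
    apply: Rmult_le_compat_l; last exact: weight_seq_logconvex.
    by apply: Rlt_le; do !apply: Rmult_lt_0_compat => //; exact: pow_lt.
  - by move=> m s s_in; have := bF m s s_in; have := Rle_abs (- F m s); rewrite Rabs_Ropp; lra.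
  - by apply: quasianalytic_rescale => //; exact: qM.
  - by move=> m; rewrite F0; apply: Rmult_le_pos => //; exact: pos_INR.
(* Adding 1 makes the constant positive even if [F 0 d] vanishes. *)
exists (F 0%N d + 1), (/ d).
split; first by have := F_ge0 0%N d ltac:(lra); lra.
split; first exact: Rinv_0_lt_compat.
move=> n; have := @nonnegative_derivatives_taylor F d dF n ltac:(lra) F_ge0.
rewrite F0.
have -> : c n * INR (Factorial.fact n) / INR (Factorial.fact n) = c n.
  by field; exact: INR_fact_neq_0.
have dn_gt0 := pow_lt d n d_gt0; rewrite pow_inv => H.
apply: (Rmult_le_reg_r (d ^ n)) => //.
have -> : (F 0%N d + 1) * / d ^ n * d ^ n = F 0%N d + 1 by field; lra.
lra.
Qed.

(** For [n >= 1] the constant is absorbed by [B <= (B + 1) ^ n], so the n-th root is bounded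
    uniformly in [n]. *)
Lemma geometric_bound_root (B q : R) (n : nat) (y : R) :
  0 < B -> 0 < q -> (1 <= n)%N -> 0 < y -> y <= B * q ^ n ->
  Rpower y (/ INR n) <= (B + 1) * q.
Proof.
move=> B_gt0 q_gt0 n_gt0 y_gt0 le_y.
have n_ge1 : 1 <= INR n by apply: (le_INR 1); apply/leP.
have in_gt0 : 0 < / INR n by apply: Rinv_0_lt_compat; lra.
have Bq_gt0 : 0 < (B + 1) * q by apply: Rmult_lt_0_compat; lra.
have le_pow : y <= ((B + 1) * q) ^ n.
  apply: Rle_trans le_y _; rewrite Rpow_mult_distr.
  apply: Rmult_le_compat_r; first by apply: pow_le; lra.
  case: n n_gt0 {n_ge1 in_gt0} => // n _ /=.
  have : 1 <= (B + 1) ^ n by apply: pow_R1_Rle; lra.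
  nra.
apply: Rle_trans (Rle_Rpower_l _ _ _ (Rlt_le _ _ in_gt0) (conj y_gt0 le_pow)) _.
rewrite -Rpower_pow // Rpower_mult Rinv_r; last lra.
by rewrite Rpower_1 //; lra.
Qed.

(** * Perturbation inside the sequence space *)

Lemma mseq_gt0 (M : nat -> R) (n : nat) : WeightSeq M -> 0 < mseq M n.
Proof. by move=> [M_gt0 _]; apply: Rdiv_lt_0_compat => //; exact: INR_fact_lt_0. Qed.

Lemma weight_matrix_mseq (Mat : R -> nat -> R) :
  WeightMatrix Mat -> forall l k, 0 < l -> l <= k ->
  forall p, mseq (Mat l) p <= mseq (Mat k) p.
Proof.
move=> [_ mM] l k l_gt0 lelk p; apply: Rmult_le_compat_r; last exact: mM.
by apply: Rlt_le; apply: Rinv_0_lt_compat; exact: INR_fact_lt_0.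
Qed.

Lemma in_lambda_add (Nat : R -> nat -> R) (r : nat) (b c : mindex r -> R) :
  WeightMatrix Nat -> InLambda Nat b -> InLambda Nat c ->
  InLambda Nat (fun a => b a + c a).
Proof.
move=> wN [l1 [h1 [C1 [? [? Hb]]]]] [l2 [h2 [C2 [? [? Hc]]]]].
have := Rmax_l l1 l2; have := Rmax_r l1 l2.
have := Rmax_l h1 h2; have := Rmax_r h1 h2 => ? ? ? ?.
exists (Rmax l1 l2), (Rmax h1 h2), (Rabs C1 + Rabs C2).
do 2!(split; first lra).
have mono C h l n : 0 < h <= Rmax h1 h2 -> 0 < l <= Rmax l1 l2 ->
    C * (h ^ n * mseq (Nat l) n) <=
    Rabs C * (Rmax h1 h2 ^ n * mseq (Nat (Rmax l1 l2)) n).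
  move=> h_in l_in.
  have m_gt0 := mseq_gt0 _ n (proj1 wN l ltac:(lra)).
  have hn_ge0 : 0 <= h ^ n by apply: pow_le; lra.
  apply: (Rle_trans _ (Rabs C * (h ^ n * mseq (Nat l) n))).
    by apply: Rmult_le_compat_r; [nra|exact: Rle_abs].
  apply: Rmult_le_compat_l; first exact: Rabs_pos.
  apply: Rmult_le_compat => //; first lra.
    by apply: pow_incr; lra.
  by apply: weight_matrix_mseq => //; lra.
move=> a; apply: Rle_trans (Rabs_triang _ _) _; rewrite Rmult_plus_distr_r.
apply: Rplus_le_compat.
  by apply: Rle_trans (Hb a) _; apply: mono; lra.
by apply: Rle_trans (Hc a) _; apply: mono; lra.
Qed.

Theorem mainTheorem13 (r : nat) (Mat Nat : R -> nat -> R) :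
  (0 < r)%nat ->
  WeightMatrix Mat -> QuasianalyticMatrix Mat ->
  WeightMatrix Nat -> QuasianalyticMatrix Nat ->
  (forall l : R, (0 < l)%R -> forall B : R, exists k : nat, (1 <= k)%nat /\
       (B < Rpower (mseq (Nat l) k) (/ INR k))%R) ->
  DenseInLambda Nat
    (fun b : mindex r -> R => InLambda Nat b /\ ~ InJetImage Mat b).
Proof.
move=> r_gt0 wM qM wN _ supN; split=> [b []//|b Lb W [_ [_ ballW]]].
have [e [e_gt0 He]] := ballW 1%N isT.
have m_gt0 n := mseq_gt0 _ n (proj1 wN 1 Rlt_0_1).
(* Multiples of the sequence [n_|a|]; for [0 <= s <= e] they lie in the ball of radius [e] of the
   first Banach space, hence in [W]. *)
pose c s (a : mindex r) := s * mseq (Nat 1) (mlen a).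
have c_norm s : 0 <= s <= e -> seqnorm_le (Nat 1) 1 (c s) e.
  move=> s_in a; have m := m_gt0 (mlen a).
  by rewrite /c pow1 Rabs_pos_eq; nra.
have Wc s : 0 <= s <= e -> W (c s) by move=> s_in; apply: He; exact: c_norm.
have Lc s : 0 <= s <= e -> InLambda Nat (fun a => b a + c s a).
  move=> s_in; apply: in_lambda_add => //.
  by exists 1, 1, e; do 2!(split; first lra); exact: c_norm.
(* If [b] is already outside the image, the zero perturbation works; otherwise [c e] moves it
   outside. *)
case: (classic (InJetImage Mat b)) => [Jb|nJb]; last first.
  exists (c 0); split; first by apply: Wc; lra.
  split; first by apply: Lc; lra.
  have -> // : (fun a => b a + c 0 a) = b.
  by apply: functional_extensionality => a; rewrite /c; ring.
exists (c e); split; first by apply: Wc; lra.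
split; first by apply: Lc; lra.
move=> Jbc; pose i := Ordinal r_gt0.
(* Subtracting the two jets cancels [b] and leaves a nonnegative axis jet. *)
have := axis_jet_sub Mat _ _ wM (jet_image_axis Mat r i b wM Jb)
  (jet_image_axis Mat r i _ wM Jbc).
have -> : (fun n => b (axis_index i n) + c e (axis_index i n) - b (axis_index i n)) =
    (fun n => e * mseq (Nat 1) n).
  by apply: functional_extensionality => n; rewrite /c mlen_axis_index; ring.
case/(axis_jet_nonneg_bound Mat _ wM qM).
  by move=> n; apply: Rmult_le_pos; [lra|exact: Rlt_le].
move=> B [q [B_gt0 [q_gt0 bound]]].
(* The threshold is the root bound for [mseq (Nat 1) k <= B / e * q ^ k], obtained by dividing
   [bound] by [e]. *)
have [k [k_gt0]] := supN 1 Rlt_0_1 ((B / e + 1) * q).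
apply: Rle_not_lt; apply: geometric_bound_root => //.
  exact: Rdiv_lt_0_compat.
apply: (Rmult_le_reg_l e) => //.
have -> : e * (B / e * q ^ k) = B * q ^ k by field; lra.
exact: bound.
Qed.
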